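(* Let $G$ be a fixed edge-ordered graph with minimal edge $e_0$ and maximal edge $e_{\max}$. If $e_0$ and $e_{\max}$ are both isolated in $G$, then either $sat_e(n,G)=O(1)$ or $sat_e(n,G)=\Omega(n)$. Otherwise, $sat_e(n,G)=\Omega(n)$.
   Context: An edge-ordered graph is a finite simple graph together with a linear order on its edge set (usually given by an injective labeling $l:E\to\mathbb{N}$ or $l:E\to\mathbb{R}$). An edge-ordered graph $H$ contains $G$ (has a copy of $G$) if $G$ is isomorphic, by an isomorphism respecting the edge-order, to a subgraph of $H$ with the induced order; otherwise $H$ is $G$-free. The minimal (maximal) edge is the edge with the smallest (largest) label; an edge is isolated if it shares no vertex with any other edge. $sat_e(n,G)$ is the minimum number of edges in a $G$-free edge-ordered graph $H$ on $n$ vertices such that adding to $H$ any missing edge, inserted at an arbitrary position of the linear order of the edges, creates a copy of $G$ (i.e. for every missing edge and every position, a copy is created). Asymptotic notation is for $n\to\infty$ with $G$ fixed ($n$ is assumed large enough). *)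

(* Defs.v *)
From HB Require Import structures.
From mathcomp Require Import all_boot all_order all_algebra.
From mathcomp Require Import all_classical all_reals topology normedtype landau.
Import numFieldNormedType.Exports.

Set Implicit Arguments.
Unset Strict Implicit.
Unset Printing Implicit Defensive.

Local Open Scope nat_scope.

(* A finite simple graph on V (an edge is a 2-element set of vertices; isolated
   vertices are allowed) together with a linear order on its edges.  Only the
   restriction of [edge_le] to [edges] is meaningful. *)
Record eograph (V : finType) := EOGraph {
  edges : {set {set V}};
  edge_le : rel {set V};
  card_edge : {in edges, forall e : {set V}, #|e| = 2};
  edge_le_total : {in edges &, total edge_le};
  edge_le_anti : {in edges &, antisymmetric edge_le};
  edge_le_trans : {in edges & &, transitive edge_le}
}.

Definition min_edge (V : finType) (G : eograph V) (e : {set V}) : Prop :=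
  e \in edges G /\ {in edges G, forall f, edge_le G e f}.

Definition max_edge (V : finType) (G : eograph V) (e : {set V}) : Prop :=
  e \in edges G /\ {in edges G, forall f, edge_le G f e}.

Definition isolated_edge (V : finType) (G : eograph V) (e : {set V}) : Prop :=
  e \in edges G /\ {in edges G, forall f, f != e -> [disjoint e & f]}.

(* The image of the embedding phi is the subgraph of H isomorphic to G. *)
Definition contains (V W : finType) (H : eograph W) (G : eograph V) : Prop :=
  exists phi : V -> W,
    [/\ injective phi,
        {in edges G, forall e : {set V}, phi @: e \in edges H} &
        {in edges G &, forall e f : {set V},
           edge_le H (phi @: e) (phi @: f) = edge_le G e f}].

(* H' is H with the edge e inserted somewhere in the order of the edges; letting
   H' range over all such graphs ranges over all positions of e. *)
Definition edge_insertion (W : finType) (H : eograph W) (e : {set W})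
    (H' : eograph W) : Prop :=
  edges H' = e |: edges H /\
  {in edges H &, forall f g, edge_le H' f g = edge_le H f g}.

Definition saturated (V W : finType) (G : eograph V) (H : eograph W) : Prop :=
  ~ contains H G /\
  forall (e : {set W}) (H' : eograph W),
    #|e| = 2 -> e \notin edges H -> edge_insertion H e H' -> contains H' G.

Definition sat_size (V : finType) (n : nat) (G : eograph V) : pred nat :=
  fun m => `[< exists2 H : eograph 'I_n, saturated G H & #|edges H| = m >].

(* The value 0 of the second branch is never used when G has an edge: see
   [sat_size_ex] and [sat_eP]. *)
Definition sat_e (V : finType) (n : nat) (G : eograph V) : nat :=
  if pselect (exists m, sat_size n G m) is left ex_sat then ex_minn ex_sat
  else 0.

Lemma saturated_ex (V W : finType) (G : eograph V) (H : eograph W) :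
  ~ contains H G -> exists H' : eograph W, saturated G H'.
Proof.
have [k] := ubnP (#|{set W}| - #|edges H|).
elim: k H => // k IHk H ltk nHG.
have [satH|] := pselect (saturated G H); first by exists H.
move=> nsatH; have [[e [H' [He eH insH nH'G]]]|nex] := pselect (exists (e : {set W}) (H' : eograph W),
  [/\ #|e| = 2, e \notin edges H, edge_insertion H e H' & ~ contains H' G]).
  apply: (IHk H') => //; case: insH => -> _; rewrite cardsU1 eH.
  have : #|e |: edges H| <= #|{set W}| by exact: max_card.
  rewrite cardsU1 eH => leH; rewrite -ltnS; apply: leq_trans ltk.
  by rewrite ltnS ltn_sub2l // -addn1 addnC.
exfalso; apply: nsatH; split=> // e H' He eH insH; apply: contrapT => nH'G.
by apply: nex; exists e, H'.
Qed.

Lemma sat_size_ex (V : finType) (n : nat) (G : eograph V) :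
  edges G != finset.set0 -> exists m, sat_size n G m.
Proof.
move=> /finset.set0Pn[e eG].
have in0 (e' : {set 'I_n}) : e' \in finset.set0 -> False by rewrite inE.
pose H0 : eograph 'I_n := @EOGraph _ finset.set0 (fun _ _ => true)
  (fun _ h => False_ind _ (in0 _ h))
  (fun _ _ h _ => False_ind _ (in0 _ h))
  (fun _ _ h _ => False_ind _ (in0 _ h))
  (fun _ _ _ h _ _ => False_ind _ (in0 _ h)).
have [|H satH] := @saturated_ex _ _ G H0.
  by case=> phi [_ /(_ e eG)]; rewrite inE.
by exists #|edges H|; apply/asboolP; exists H.
Qed.

Lemma sat_eP (V : finType) (n : nat) (G : eograph V) :
  edges G != finset.set0 ->
  (exists2 H : eograph 'I_n, saturated G H & #|edges H| = sat_e n G) /\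
  (forall H : eograph 'I_n, saturated G H -> sat_e n G <= #|edges H|).
Proof.
move=> /(@sat_size_ex _ n) exG; rewrite /sat_e; case: pselect => // ex_sat.
case: ex_minnP => m /asboolP[H satH Hm] minm; split; first by exists H.
by move=> H' satH'; apply: minm; apply/asboolP; exists H'.
Qed.

(* Main.v *)
Require Import Defs.
From mathcomp Require Import all_boot all_order all_algebra.
From mathcomp Require Import all_classical all_reals topology normedtype landau.
From mathcomp Require Import zify.
Import GRing.Theory Num.Theory.
Import numFieldNormedType.Exports.

Set Implicit Arguments.
Unset Strict Implicit.
Unset Printing Implicit Defensive.

(** A saturated graph [H] on at least [#|V|] vertices with at least two isolated
    vertices stays saturated when isolated vertices are added to it: a new edge
    only sees its at most two isolated ends, which can be moved to isolated
    vertices of [H].  So either such an [H] exists for some [n], and [sat_e] is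
    bounded, or every saturated graph has at most one isolated vertex, hence at
    least [(n - 1) / 2] edges.  If two isolated vertices of [H] are joined by a
    new edge inserted as the least one, this edge must play the role of [e0] in
    the copy of [G], so [e0] is isolated; the same holds for [emax], and the
    first alternative is excluded when [e0] or [emax] is not isolated. *)

Local Notation cover := finset.cover.

(** * Transport of edge orders along maps of edges *)

Section Pullback.

Variables (W W' : finType) (H : eograph W') (F : {set W} -> {set W'}).
Variable A : {set {set W}}.
Hypothesis cardA : {in A, forall e : {set W}, #|e| = 2}.
Hypothesis injF : {in A &, injective F}.
Hypothesis FA : {in A, forall e, F e \in edges H}.

(** [F] acts on edges rather than on vertices, so that it can be a direct image under an embedding
    as well as, in [push], a preimage. *)
Definition pullback : eograph W.
Proof.
refine (@EOGraph _ A (fun e f => edge_le H (F e) (F f)) cardA _ _ _).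
- by move=> e f eA fA; apply: edge_le_total; apply: FA.
- move=> e f eA fA lef; apply: injF => //.
  by apply: edge_le_anti lef; apply: FA.
- by move=> e f g eA fA gA; apply: edge_le_trans; apply: FA.
Defined.

End Pullback.

Lemma contains_pullback_imset (V W W' : finType) (G : eograph V)
    (H : eograph W') (j : W -> W') (A : {set {set W}})
    (cardA : {in A, forall e : {set W}, #|e| = 2})
    (injF : {in A &, injective (fun e : {set W} => j @: e)})
    (FA : {in A, forall e : {set W}, j @: e \in edges H}) :
  injective j -> contains (pullback cardA injF FA) G -> contains H G.
Proof.
move=> jI [phi [phiI phiE phiL]]; exists (j \o phi); split.
- exact: inj_comp.
- by move=> e eG; rewrite imset_comp; exact (FA _ (phiE e eG)).
- by move=> e f eG fG; rewrite (imset_comp j phi e) (imset_comp j phi f) -phiL.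
Qed.

Section Pushforward.

Variables (W W' : finType) (H : eograph W) (j : W -> W').
Hypothesis jI : injective j.

Let jK (e : {set W}) : j @^-1: (j @: e) = e.
Proof. by apply/setP=> x; rewrite inE mem_imset. Qed.

Definition push_edges : {set {set W'}} :=
  [set j @: (e : {set W}) | e in edges H].

Lemma card_push_edge : {in push_edges, forall e : {set W'}, #|e| = 2}.
Proof. by move=> _ /imsetP[e eH ->]; rewrite card_imset // (card_edge eH). Qed.

Lemma preim_push_inj :
  {in push_edges &, injective (fun e : {set W'} => j @^-1: e)}.
Proof. by move=> _ _ /imsetP[e _ ->] /imsetP[f _ ->] /=; rewrite !jK => ->. Qed.

Lemma preim_push : {in push_edges, forall e : {set W'}, j @^-1: e \in edges H}.
Proof. by move=> _ /imsetP[e eH ->]; rewrite jK. Qed.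

Definition push : eograph W' := pullback card_push_edge preim_push_inj preim_push.

Lemma push_le (e f : {set W}) : edge_le push (j @: e) (j @: f) = edge_le H e f.
Proof. by rewrite /= !jK. Qed.

Lemma card_push_edges : #|edges push| <= #|edges H|.
Proof. exact: leq_imset_card. Qed.

End Pushforward.

(** * Embeddings and the addition of isolated vertices *)

Lemma extend_injection (V W : finType) (S : {set V}) (f : V -> W) :
  #|V| <= #|W| -> {in S &, injective f} ->
  exists2 g : V -> W, injective g & {in S, g =1 f}.
Proof.
move=> leVW fI.
have [w0|/(_ _)W0] := pickP W; last first.
  have V0 (x : V) : False by have := W0 (f x).
  by exists f => x; have := V0 x.
(* The i-th element outside [S] goes to the i-th element outside [f @: S]; by [sizeT] there are
   enough of these, so the default [w0] is never reached. *)
pose T := enum (~: (f @: S)).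
have sizeT : #|~: S| <= size T.
  rewrite -cardE -(leq_add2l #|S|) cardsC -(card_in_imset fI).
  by rewrite cardsC.
pose g x := if x \in S then f x else nth w0 T (index x (enum (~: S))).
have ltT x : x \notin S -> index x (enum (~: S)) < size T.
  by move=> xS; apply: leq_trans sizeT; rewrite cardE index_mem mem_enum inE.
have gT x : x \notin S -> g x \notin f @: S.
  move=> xS; have := mem_nth w0 (ltT x xS).
  by rewrite mem_enum inE /g (negPf xS).
exists g; last by move=> x xS; rewrite /g xS.
move=> x y.
have [xS|xS] := boolP (x \in S); have [yS|yS] := boolP (y \in S).
- by rewrite /g xS yS; apply: fI.
- by move=> gxy; have := gT y yS; rewrite -gxy /g xS imset_f.
- by move=> gxy; have := gT x xS; rewrite gxy /g yS imset_f.
rewrite /g (negPf xS) (negPf yS) => /eqP.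
rewrite nth_uniq ?ltT ?enum_uniq // => /eqP /(congr1 (nth x (enum (~: S)))).
by rewrite !nth_index // mem_enum inE.
Qed.

Lemma eq_imset_in_cover (W W' : finType) (A : {set {set W}}) (j k : W -> W') :
  {in cover A, j =1 k} -> {in A, forall e : {set W}, j @: e = k @: e}.
Proof.
move=> jk e eA; apply: eq_in_imset => x xe.
by apply: jk; apply/bigcupP; exists e.
Qed.

(** Edges of [push H jI] lie in the image of [j], so a copy of [G] can be pulled back on the
    vertices that edges of [G] cover. Its isolated vertices may lie outside this image; they find
    new places in [W] because [#|V| <= #|W|]. *)
Lemma contains_push (V W W' : finType) (G : eograph V) (H : eograph W)
    (j : W -> W') (jI : injective j) :
  #|V| <= #|W| -> contains (push H jI) G -> contains H G.
Proof.
move=> leVW [phi [phiI phiE phiL]].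
have ex_pre x : x \in cover (edges G) -> exists y, j y = phi x.
  case/bigcupP=> e eG xe; have /imsetP[f _ ef] := phiE e eG.
  have : phi x \in phi @: e by apply: imset_f.
  by rewrite ef => /imsetP[y _ ->]; exists y.
have [psi0 psi0P] : exists psi : V -> W,
    {in cover (edges G), forall x, j (psi x) = phi x}.
  have ex x : exists y, x \in cover (edges G) -> j y = phi x.
    (* Off the covered vertices any value will do, and [x] itself shows that [W] is not empty. *)
    have [/ex_pre[y]|_] := boolP (x \in cover (edges G)); first by exists y.
    have /card_gt0P[y _] : 0 < #|W|.
      by apply: leq_trans leVW; apply/card_gt0P; exists x.
    by exists y.
  by have [psi psiP] := choice ex; exists psi.
have psi0I : {in cover (edges G) &, injective psi0}.
  by move=> x y xG yG /(congr1 j); rewrite !psi0P // => /phiI.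
have [psi psiI psiE] := extend_injection leVW psi0I.
have jpsi : {in edges G, forall e : {set V}, phi @: e = j @: (psi @: e)}.
  move=> e eG; rewrite -imset_comp; apply/esym; move: e eG.
  by apply: eq_imset_in_cover => x xG /=; rewrite psiE ?psi0P.
exists psi; split=> //.
- move=> e eG; have := phiE e eG; rewrite jpsi // => /imsetP[f fH].
  by move/(imset_inj jI) => ->.
- by move=> e f eG fG; rewrite -phiL // !jpsi // push_le.
Qed.

(** If [a] or [b] is already a value of [j], its preimage is kept; otherwise a vertex outside [C] is
    redirected to it. Two vertices outside [C] are enough to keep the two choices distinct. *)
Lemma embedding_through_pair (W W' : finType) (C : {set W}) (j : W -> W')
    (a b : W') :
  injective j -> 1 < #|~: C| -> a != b ->
  exists k : W -> W', [/\ injective k, {in C, k =1 j} &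
    exists p q, k p = a /\ k q = b].
Proof.
move=> jI /card_gt1P[u [v [uC vC uv]]] ab.
have other x : exists2 y, y \in ~: C & x != y.
  have [->|xu] := eqVneq x u; first by exists v.
  by exists u.
(* [rep c p] makes it safe to send [p] to [c]: [j] is unchanged on [C], and no other vertex has the
   value [c]. *)
pose rep c p := j p = c \/ (p \in ~: C) /\ (forall x, j x <> c).
have repP c : (exists x, j x = c) \/ (forall x, j x <> c).
  have [[x xc]|nex] := pselect (exists x, j x = c); [by left; exists x|right].
  by move=> x xc; apply: nex; exists x.
have [p [q [pq pa qb]]] : exists p q, [/\ p != q, rep a p & rep b q].
  have [[p jp]|na] := repP a; have [[q jq]|nb] := repP b.
  - exists p, q; split; [|by left|by left].
    by apply: contraNneq ab => pq; rewrite -jp -jq pq.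
  - have [q qC pq] := other p.
    by exists p, q; split=> //; [left|right].
  - have [p pC qp] := other q.
    by exists p, q; split; [rewrite eq_sym|right|left].
  - by exists u, v; split=> //; right.
pose k x := if x == p then a else if x == q then b else j x.
have ja x : x != p -> j x != a.
  case: pa => [<-|[_ na] _]; first by rewrite (inj_eq jI).
  exact/eqP/na.
have jb x : x != q -> j x != b.
  case: qb => [<-|[_ nb] _]; first by rewrite (inj_eq jI).
  exact/eqP/nb.
exists k; split.
- move=> x y; rewrite /k.
  case: (eqVneq x p) => [->|xp]; case: (eqVneq y p) => [->|yp] //.
  + case: eqVneq => [_|yq] /eqP; first by rewrite (negPf ab).
    by rewrite eq_sym (negPf (ja _ yp)).
  + case: eqVneq => [_|xq] /eqP; first by rewrite eq_sym (negPf ab).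
    by rewrite (negPf (ja _ xp)).
  + case: (eqVneq x q) => [->|xq]; case: (eqVneq y q) => [->|yq] //.
    * by move/eqP; rewrite eq_sym (negPf (jb _ yq)).
    * by move/eqP; rewrite (negPf (jb _ xq)).
    * exact: jI.
- move=> x xC; rewrite /k; case: eqVneq => [xp|_].
    by case: pa => [<-|[]]; [rewrite xp|rewrite -xp inE xC].
  case: eqVneq => [xq|//].
  by case: qb => [<-|[]]; [rewrite xq|rewrite -xq inE xC].
- by exists p, q; rewrite /k !eqxx eq_sym (negPf pq).
Qed.

Lemma saturated_push (V W W' : finType) (G : eograph V) (H : eograph W)
    (j : W -> W') (jI : injective j) :
  #|V| <= #|W| -> 1 < #|~: cover (edges H)| ->
  saturated G H -> saturated G (push H jI).
Proof.
move=> leVW isoH [nHG satH]; split; first by move/(contains_push leVW).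
move=> e H' e2 eH [H'E H'L].
have /eqP/cards2P[a [b [ab eab]]] := e2.
have [k [kI kj [p [q [kp kq]]]]] := embedding_through_pair jI isoH ab.
pose e' := [set p; q].
have ke' : k @: e' = e by rewrite imsetU1 imset_set1 kp kq eab.
have kjE := eq_imset_in_cover kj.
have e'2 : #|e'| = 2 by rewrite -e2 -ke' card_imset.
have e'H : e' \notin edges H.
  apply: contra eH => e'H; rewrite -ke' kjE //; exact: imset_f.
have cardA : {in e' |: edges H, forall f : {set W}, #|f| = 2}.
  by move=> f /setU1P[->//|/card_edge].
have injF : {in e' |: edges H &, injective (fun f : {set W} => k @: f)}.
  by move=> f g _ _; apply: imset_inj.
have FA : {in e' |: edges H, forall f : {set W}, k @: f \in edges H'}.
  move=> f /setU1P[->|fH]; rewrite H'E; first by rewrite ke' setU11.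
  by rewrite kjE // setU1r // imset_f.
(* Pulling the order of [H'] back along [k] inserts [e'] into [H] at the position that [e] has in
   [H']; saturation of [H] gives a copy of [G], which [k] carries into [H']. *)
apply: (contains_pullback_imset (cardA := cardA) (injF := injF) (FA := FA) kI).
apply: (satH e') => //; split=> // f g fH gH.
by rewrite /= !kjE // H'L ?push_le //; apply: imset_f.
Qed.

(** * A new least edge between two isolated vertices *)

Section LeastInsertion.

Variables (W : finType) (H : eograph W) (e : {set W}).
Hypotheses (e2 : #|e| = 2) (eH : e \notin edges H).

Let in_old f : f \in e |: edges H -> f != e -> f \in edges H.
Proof. by move=> /setU1P[->|//]; rewrite eqxx. Qed.

Definition insert_least : eograph W.
Proof.
refine (@EOGraph _ (e |: edges H)
  (fun f g => (f == e) || (g != e) && edge_le H f g) _ _ _ _).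
- by move=> f /setU1P[->//|/card_edge].
- move=> f g fH gH; case: (eqVneq f e) => //= fe; case: (eqVneq g e) => //= ge.
  by apply: edge_le_total; apply: in_old.
- move=> f g fH gH; case: (eqVneq f e) => [->|fe]; case: (eqVneq g e) => [->|ge] //=.
  by apply: edge_le_anti; apply: in_old.
- move=> g f h gH fH hH.
  case: (eqVneq f e) => //= fe; case: (eqVneq g e) => //= ge.
  case: (eqVneq h e) => //= he.
  by apply: edge_le_trans; apply: in_old.
Defined.

Lemma insert_leastP : edge_insertion H e insert_least.
Proof.
split=> // f g fH gH /=.
have ne h : h \in edges H -> h != e by apply: contraTneq => ->.
by rewrite (negPf (ne f fH)) (ne g gH).
Qed.

End LeastInsertion.

Lemma isolated_min_edge (V W : finType) (G : eograph V) (H : eograph W)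
    (e0 : {set V}) :
  min_edge G e0 -> saturated G H -> 1 < #|~: cover (edges H)| ->
  isolated_edge G e0.
Proof.
move=> [e0G e0min] [nHG satH] /card_gt1P[u [v [uC vC uv]]].
pose e := [set u; v].
have e2 : #|e| = 2 by rewrite cards2 uv.
have notC x f : x \in e -> f \in edges H -> x \notin f.
  move=> xe fH; apply: contraTN (_ : x \in ~: cover (edges H)).
    by move=> xf; rewrite inE negbK; apply/bigcupP; exists f.
  by case/set2P: xe => ->.
have eH : e \notin edges H.
  by apply/negP=> /(notC u); rewrite !set21 => /(_ isT).
have [phi [phiI phiE phiL]] := satH e _ e2 eH (insert_leastP e2 eH).
(* The copy uses [e]; otherwise it would lie in [H], where the insertion leaves the order
   unchanged. *)
have [g gG phig] : exists2 g : {set V}, g \in edges G & phi @: g = e.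
  apply: contrapT => nex; apply: nHG; exists phi.
  have old g : g \in edges G -> phi @: g != e /\ phi @: g \in edges H.
    move=> gG; have ne : phi @: g != e by apply/eqP=> ?; apply: nex; exists g.
    by split=> //; have /setU1P[/eqP|//] := phiE g gG; rewrite (negPf ne).
  split=> // [g /old[]//|f g fG gG]; rewrite -phiL //=.
  have [fe _] := old f fG; have [ge _] := old g gG.
  by rewrite (negPf fe) ge.
(* The image of [e0] is at most [phi @: g], that is [e], and only [e] itself is at most [e]. *)
have phi0 : phi @: e0 = e.
  have := e0min g gG; rewrite -phiL // phig /= eqxx orbF.
  by move/eqP.
(* A vertex shared by [e0] and [f] would map to an end of [e] lying on an edge of [H], but the ends
   of [e] are isolated in [H]. *)
split=> // f fG fe0; apply/pred0P=> x /=; apply/negP => /andP[xe0 xf].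
have phife : phi @: f != e by rewrite -phi0 (inj_eq (imset_inj phiI)).
have /setU1P[/eqP|fH] := phiE f fG; first by rewrite (negPf phife).
by have := notC (phi x) (phi @: f); rewrite -phi0 !imset_f // => /(_ isT fH).
Qed.

(** * Order reversal, which exchanges minimal and maximal edges *)

Definition reverse (W : finType) (H : eograph W) : eograph W.
Proof.
refine (@EOGraph _ (edges H) (fun e f => edge_le H f e) (@card_edge _ H) _ _ _).
- by move=> e f eH fH; apply: edge_le_total.
- by move=> e f eH fH; rewrite andbC; apply: edge_le_anti.
- by move=> e f g eH fH gH lefe leeg; apply: edge_le_trans leeg lefe.
Defined.

Lemma contains_reverse (V W : finType) (G : eograph V) (H : eograph W) :
  contains (reverse H) G -> contains H (reverse G).
Proof.
by case=> phi [phiI phiE phiL]; exists phi; split=> // e f eG fG; apply: phiL.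
Qed.

(** Reversing an insertion into [reverse H] gives an insertion into [H] at the opposite position, so
    saturation of [H] handles every position. *)
Lemma saturated_reverse (V W : finType) (G : eograph V) (H : eograph W) :
  saturated G H -> saturated (reverse G) (reverse H).
Proof.
move=> [nHG satH]; split.
  case=> phi [phiI phiE phiL]; apply: nHG; exists phi.
  by split=> // e f eG fG; apply: phiL.
move=> e H' e2 eH [H'E H'L]; apply: contains_reverse; apply: (satH e) => //.
by split=> // f g fH gH; apply: H'L.
Qed.

Lemma isolated_max_edge (V W : finType) (G : eograph V) (H : eograph W)
    (e : {set V}) :
  max_edge G e -> saturated G H -> 1 < #|~: cover (edges H)| ->
  isolated_edge G e.
Proof.
move=> maxe /saturated_reverse satH isoH.
(* By conversion, [maxe] says that [e] is minimal in [reverse G]; reversal keeps the edge set, hence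
   also isolation. *)
exact: (@isolated_min_edge _ _ (reverse G) _ _ maxe satH).
Qed.

(** * Bounds for each number of vertices *)

Lemma leq_card_few_isolated (W : finType) (H : eograph W) :
  #|~: cover (edges H)| <= 1 -> #|W| <= 2 * #|edges H| + 1.
Proof.
move=> iso1; rewrite -(cardsC (cover (edges H))); apply: leq_add => //.
apply: leq_trans (leq_of_leqif (leq_card_cover _)) _.
by rewrite (eq_bigr (fun=> 2)) ?sum_nat_const 1?mulnC // => e /card_edge.
Qed.

Lemma sat_e_bounded (V : finType) (n : nat) (G : eograph V) (H : eograph 'I_n) :
  edges G != finset.set0 -> #|V| <= n -> saturated G H ->
  1 < #|~: cover (edges H)| ->
  forall m, n <= m -> sat_e m G <= #|edges H|.
Proof.
move=> G0 leVn satH isoH m lenm.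
have jI : injective (widen_ord lenm) by move=> x y /(congr1 val) /= /val_inj.
apply: leq_trans (card_push_edges H jI).
by apply: (sat_eP m G0).2; apply: saturated_push => //; rewrite card_ord.
Qed.

Lemma sat_e_linear (V : finType) (n : nat) (G : eograph V) :
  edges G != finset.set0 ->
  (forall H : eograph 'I_n, saturated G H -> #|~: cover (edges H)| <= 1) ->
  n <= 2 * sat_e n G + 1.
Proof.
move=> /(sat_eP n)[[H satH <-] _] /(_ H satH) /leq_card_few_isolated.
by rewrite card_ord.
Qed.

(** * Asymptotic form of the bounds *)

Local Open Scope ring_scope.
Local Open Scope classical_set_scope.

Lemma sat_e_bigO1 (R : realType) (V : finType) (n : nat) (G : eograph V)
    (H : eograph 'I_n) :
  edges G != finset.set0 -> (#|V| <= n)%N -> saturated G H ->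
  (1 < #|~: cover (edges H)|)%N ->
  (fun n : nat => (sat_e n G)%:R : R) =O_\oo (fun _ : nat => 1 : R).
Proof.
move=> G0 leVn satH isoH; apply/eqO_exP.
(* The successor makes the constant positive even if [H] has no edge. *)
exists (#|edges H|.+1)%:R; first by rewrite ltr0n.
near=> m; rewrite normr1 mulr1 normr_nat ler_nat leqW //.
by apply: (sat_e_bounded G0 leVn satH isoH); near: m; apply: nbhs_infty_ge.
Unshelve. all: by end_near. Qed.

(** The threshold [N] allows for graphs with fewer than [#|V|] vertices, to which [saturated_push]
    does not apply. *)
Lemma sat_e_bigOmega (R : realType) (V : finType) (G : eograph V) (N : nat) :
  edges G != finset.set0 ->
  (forall n (H : eograph 'I_n), (N <= n)%N -> saturated G H ->
     (#|~: cover (edges H)| <= 1)%N) ->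
  (fun n : nat => (sat_e n G)%:R : R) =Omega_\oo (fun n : nat => n%:R : R).
Proof.
(* From [n <= 2 * sat_e n G + 1] and [2 <= n] it follows that [n <= 4 * sat_e n G]. *)
move=> G0 iso1; rewrite eqOmegaE eqOmegaO; apply/eqO_exP; exists 4 => //.
near=> n; rewrite !normr_nat -natrM ler_nat.
have leNn : (N <= n)%N by near: n; apply: nbhs_infty_ge.
have le2n : (2 <= n)%N by near: n; apply: nbhs_infty_ge.
have := sat_e_linear G0 (fun H => iso1 n H leNn); lia.
Unshelve. all: by end_near. Qed.

Theorem theorem9 (R : realType) (V : finType) (G : eograph V)
    (e0 emax : {set V}) (He0 : min_edge G e0) (Hemax : max_edge G emax) :
  (isolated_edge G e0 /\ isolated_edge G emax ->
     (fun n : nat => (sat_e n G)%:R : R) =O_\oo (fun _ : nat => 1 : R) \/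
     (fun n : nat => (sat_e n G)%:R : R) =Omega_\oo (fun n : nat => n%:R : R)) /\
  (~ (isolated_edge G e0 /\ isolated_edge G emax) ->
     (fun n : nat => (sat_e n G)%:R : R) =Omega_\oo (fun n : nat => n%:R : R)).
Proof.
have G0 : edges G != finset.set0.
  by apply/finset.set0Pn; exists e0; case: He0.
split=> [_|niso].
  (* One large enough saturated graph with two isolated vertices bounds [sat_e] for all larger
     orders; if there is none, the linear bound holds from [#|V|] on. *)
  have [[n [H [leVn satH isoH]]]|nex] := pselect (exists n (H : eograph 'I_n),
      [/\ (#|V| <= n)%N, saturated G H & (1 < #|~: cover (edges H)|)%N]).
    by left; apply: sat_e_bigO1 isoH.
  right; apply: (@sat_e_bigOmega _ _ _ #|V|) => // n H leVn satH.
  by rewrite leqNgt; apply/negP=> isoH; apply: nex; exists n, H.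
(* The threshold is 0, since two isolated vertices in a saturated graph of any order force both
   extreme edges to be isolated. *)
apply: (@sat_e_bigOmega _ _ _ 0) => // n H _ satH.
rewrite leqNgt; apply/negP=> isoH; apply: niso.
by split; [apply: isolated_min_edge isoH|apply: isolated_max_edge isoH].
Qed.
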